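(* Let $p$ be an odd prime, let $v_2(p-1)=\lambda$ and $\max\{v_2(p-1), v_2(p+1)\}=\mu$, and let $\phi(z)=z^2$. Then $$\lim_{\substack{n \to \infty\\ v_2(n)=0}}\frac{\#\operatorname{Per}\left(\phi, \mathbb{F}_{p^n}\right)}{p^n} = \frac{1}{2^\lambda},$$ and for every integer $\nu\geq 1$, $$\lim_{\substack{n \to \infty\\ v_2(n)=\nu}}\frac{\#\operatorname{Per}\left(\phi, \mathbb{F}_{p^n}\right)}{p^n} = \frac{1}{2^{\mu+\nu}}.$$
   Context: For a polynomial $\phi$ with integer coefficients (reduced mod $p$) and a field $K$ of characteristic $p$, $\operatorname{Per}(\phi,K)=\{\alpha\in K : \phi^m(\alpha)=\alpha \text{ for some } m>0\}$, where $\phi^m$ is the $m$-th iterate of $\phi$ under composition. $\mathbb{F}_{p^n}$ is the field with $p^n$ elements. $v_2$ is the $2$-adic valuation. The limits are taken as $n\to\infty$ through the positive integers $n$ satisfying the condition displayed under the limit sign. *)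

(* Defs.v *)
From HB Require Import structures.
From mathcomp Require Import all_boot all_order all_algebra.
From mathcomp Require Import all_classical all_reals all_analysis.
Set Implicit Arguments.
Unset Strict Implicit.
Unset Printing Implicit Defensive.
Import Order.TTheory GRing.Theory Num.Theory.
Import numFieldNormedType.Exports.
Local Open Scope classical_set_scope.
Local Open Scope ring_scope.

Definition poly_iter (S : comNzRingType) (phi : {poly S}) (m : nat) : {poly S} :=
  iter m (fun q => phi \Po q) 'X.

(* When K has characteristic p, [map_poly intr] is reduction of the
   coefficients mod p followed by the inclusion of the prime field in K. *)
Definition Per (phi : {poly int}) (K : fieldType) : set K :=
  [set a | exists2 m : nat,
    (0 < m)%N & (poly_iter (map_poly intr phi) m).[a] = a].
Arguments Per : clear implicits.

(* For a finite field K this is the boolean cardinality of [Per phi K], whose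
   membership test is the classical one. *)
Definition card_Per (phi : {poly int}) (K : finFieldType) : nat :=
  #|Per phi K|.

(* [logn 2 0 = 0], hence the explicit positivity condition. *)
Definition v2_eq (nu : nat) : set nat :=
  [set n | (0 < n)%N /\ logn 2 n = nu].

(* Main.v *)
Require Import Defs.
From HB Require Import structures.
From mathcomp Require Import all_boot all_order all_algebra.
From mathcomp Require Import cyclic finfield.
From mathcomp Require Import all_classical all_reals all_analysis.
From mathcomp Require Import zify ring.
Import Order.TTheory GRing.Theory Num.Theory.
Import numFieldNormedType.Exports.
Local Open Scope classical_set_scope.
Local Open Scope ring_scope.

(** The nonzero periodic points of squaring on a field with q elements are the
    elements of odd multiplicative order.  Since the multiplicative group is
    cyclic, there are m of them, where q - 1 = 2^k m with m odd; hence
    #Per / q = 2^-k + (1 - 2^-k) / q.  For q = p^n, lifting the exponent shows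
    that k depends only on v_2(n), and it equals the exponent of the limit. *)

Lemma poly_iterX2 (S : comNzRingType) m :
  poly_iter (map_poly intr ('X^2 : {poly int}) : {poly S}) m = 'X^(2 ^ m).
Proof.
elim: m => [|m IHm]; first by rewrite expr1.
by rewrite /poly_iter iterS -/(poly_iter _ _) IHm rmorphXn /= map_polyX
  comp_Xn_poly -exprM expnSr.
Qed.

Lemma finField_pred_card_gt0 (F : finFieldType) : (0 < #|F|.-1)%N.
Proof. by rewrite -ltnS (ltn_predK (finNzRing_gt1 F)) finNzRing_gt1. Qed.

Lemma expf_pred_card (F : finFieldType) (x : F) : x != 0 -> x ^+ #|F|.-1 = 1.
Proof.
move=> x_neq0; apply: (mulfI x_neq0).
by rewrite -exprS (ltn_predK (finNzRing_gt1 F)) expf_card mulr1.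
Qed.

(** A generator of the cyclic group of units, raised to the power [#|F|.-1 %/ m], is a primitive
    [m]-th root of unity; its [m] distinct powers are all the roots. *)
Lemma card_unity_roots (F : finFieldType) m : (m %| #|F|.-1)%N ->
  #|[pred x : F | x ^+ m == 1]| = m.
Proof.
move=> m_dvd.
have q_gt0 := finField_pred_card_gt0 F.
have /hasP[z _ z_prim] : has (#|F|.-1).-primitive_root (enum (predC1 (0 : F))).
  apply: has_prim_root => //; first 1 last.
  - exact: enum_uniq.
  - by rewrite -cardE cardC1.
  apply/allP => x; rewrite mem_enum => x_neq0.
  by rewrite unity_rootE expf_pred_card.
have w_prim := dvdn_prim_root z_prim m_dvd.
set w := z ^+ _ in w_prim.
have w_inj : injective (fun i : 'I_m => w ^+ i).
  move=> i j /eqP; rewrite (eq_prim_root_expr w_prim) !modn_small //.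
  by move=> /eqP/val_inj.
rewrite -[RHS]card_ord -(card_codom w_inj); apply: eq_card => x.
rewrite inE; apply/eqP/codomP => [/(prim_rootP w_prim) [i ->]|[i ->]].
  by exists i.
by rewrite exprAC (prim_expr_order w_prim) expr1n.
Qed.

(** For nonzero [x], periodicity means x^(2^j - 1) = 1 for some j > 0, that is, odd multiplicative
    order. As the order divides [#|F|.-1], it is odd exactly when it divides the odd part of
    [#|F|.-1]. *)
Lemma mem_Per_sqr (F : finFieldType) (x : F) :
  (x \in Per 'X^2 F) = (x == 0) || (x ^+ (#|F|.-1)`_(2^')%N == 1).
Proof.
have q_gt0 := finField_pred_card_gt0 F.
apply/idP/idP.
  rewrite in_setE => -[j j_gt0]; rewrite poly_iterX2 hornerXn => xj.
  have [//|x_neq0 /=] := eqVneq x 0.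
  have x1 : x ^+ (2 ^ j).-1 = 1.
    by apply: (mulfI x_neq0); rewrite -exprS prednK ?expn_gt0 // xj mulr1.
  have [d d_prim d_dvd] := prim_order_exists q_gt0 (expf_pred_card F x x_neq0).
  rewrite -(prim_order_dvd d_prim).
  have d_odd : odd d.
    have /dvdn_odd : (d %| (2 ^ j).-1)%N by rewrite (prim_order_dvd d_prim) x1.
    by apply; case: j j_gt0 {xj x1} => // j _;
      rewrite -subn1 oddB ?expn_gt0 // oddX.
  (* The odd [d] is coprime to the 2-part of [#|F|.-1], so it divides the complementary factor. *)
  rewrite -(Gauss_dvdr (n := #|F|.-1`_2%N)) ?partnC //.
  by rewrite p_part coprimeXr // coprimen2.
case/orP=> [/eqP ->|/eqP xm].
  by rewrite in_setE; exists 1%N => //; rewrite poly_iterX2 hornerXn expr0n.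
have m_gt0 := part_gt0 (2^')%N #|F|.-1; set m := (_`_(2^'))%N in xm m_gt0 *.
(* Since [m] is odd, Euler gives 2^totient(m) = 1 mod [m], so this many squarings fix [x]. *)
rewrite in_setE; exists (totient m); first by rewrite totient_gt0.
have m_odd : coprime 2 m.
  by rewrite prime_coprime // -p'natE // part_pnat.
by rewrite poly_iterX2 hornerXn -(expr_mod _ xm) Euler_exp_totient // expr_mod.
Qed.

(** The successor accounts for the fixed point 0, which is not a root of unity. *)
Lemma card_Per_sqr (F : finFieldType) :
  card_Per 'X^2 F = ((#|F|.-1)`_(2^')%N).+1.
Proof.
rewrite /card_Per -[in RHS](@card_unity_roots F (#|F|.-1`_(2^')%N));
  last exact: dvdn_part.
rewrite -[RHS](_ : #|[predU1 0 & [pred x : F | x ^+ (#|F|.-1)`_(2^')%N == 1]]| = _).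
  by apply: eq_card => x; rewrite mem_Per_sqr !inE.
rewrite cardU1 inE expr0n gtn_eqF ?part_gt0 //.
by rewrite eq_sym oner_eq0.
Qed.

(** The cofactor of x - 1 in x^n - 1 is a sum of [n] odd terms, hence odd. *)
Lemma logn2_predX_odd x n : odd x -> (1 < x)%N -> odd n ->
  logn 2 (x ^ n).-1 = logn 2 x.-1.
Proof.
move=> x_odd x_gt1 n_odd.
have s_odd : odd (\sum_(i < n) x ^ i).
  rewrite -(big_mkord predT (expn x)) /=.
  have -> k : odd (\sum_(0 <= i < k) x ^ i) = odd k.
    elim: k => [|k IHk]; first by rewrite big_geq.
    by rewrite big_nat_recr //= oddD IHk oddX x_odd orbT addbT.
  exact: n_odd.
rewrite predn_exp lognM; [|by lia|exact: odd_gt0].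
by rewrite [X in (_ + X)%N]logn_coprime ?coprime2n // addn0.
Qed.

Lemma logn2_predX2 x : odd x -> (1 < x)%N ->
  logn 2 (x ^ 2).-1 = (logn 2 x.-1 + logn 2 x.+1)%N.
Proof.
move=> x_odd x_gt1.
by rewrite -subn1 -[1%N in LHS](exp1n 2) subn_sqr lognM ?subn1 ?addn1 //; lia.
Qed.

Lemma logn2_double_odd x : odd x -> logn 2 x.*2 = 1%N.
Proof.
move=> x_odd; rewrite -mul2n lognM //; last exact: odd_gt0.
rewrite logn_prime //.
by rewrite logn_coprime ?coprime2n.
Qed.

(** One of the consecutive even numbers x - 1 and x + 1 is twice an odd number, so the smaller
    valuation is 1. *)
Lemma logn2_pred_succ x : odd x -> (1 < x)%N ->
  (logn 2 x.-1 + logn 2 x.+1)%N = (maxn (logn 2 x.-1) (logn 2 x.+1)).+1.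
Proof.
move=> x_odd x_gt1.
have [h_odd|h_even] := boolP (odd x./2).
  have -> : x.-1 = (x./2).*2 by lia.
  rewrite logn2_double_odd //.
  have : (0 < logn 2 x.+1)%N by rewrite logn_gt0 mem_primes /= dvdn2 /= x_odd.
  lia.
have -> : x.+1 = (x./2.+1).*2 by lia.
rewrite logn2_double_odd //.
have : (0 < logn 2 x.-1)%N by rewrite logn_gt0 mem_primes /= dvdn2; lia.
lia.
Qed.

(** The odd part of [n] does not affect the valuation. The first squaring yields the maximum plus 1,
    and each further squaring adds 1. *)
Lemma logn2_predX_even x n : odd x -> (1 < x)%N -> (0 < n)%N ->
  (0 < logn 2 n)%N ->
  logn 2 (x ^ n).-1 = (maxn (logn 2 x.-1) (logn 2 x.+1) + logn 2 n)%N.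
Proof.
move=> x_odd x_gt1 n_gt0.
(* Only the exponent is factored, so that [logn 2 n] can then be generalized to [k.+1]. *)
have [m m_odd {2}->] := pfactor_coprime (isT : prime 2) n_gt0.
rewrite coprime2n in m_odd; case: (logn 2 n) => // k _.
rewrite mulnC expnM logn2_predX_odd ?oddX ?x_odd ?orbT //; last first.
  by rewrite -[ltnLHS](exp1n (2 ^ k.+1)) ltn_exp2r ?expn_gt0.
elim: k => [|k IHk].
  by rewrite expn1 logn2_predX2 // logn2_pred_succ // addn1.
rewrite (expnSr 2 k.+1) expnM logn2_predX2 ?oddX ?x_odd ?orbT //; last first.
  by rewrite -[ltnLHS](exp1n (2 ^ k.+1)) ltn_exp2r ?expn_gt0.
rewrite {}IHk.
(* An odd square is 1 mod 4, so its successor is twice an odd number. *)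
suff -> : logn 2 (x ^ (2 ^ k.+1)).+1 = 1%N by rewrite addn1 -addnS.
have y_odd : odd (x ^ (2 ^ k)) by rewrite oddX x_odd orbT.
rewrite expnSr expnM; set y := (x ^ (2 ^ k))%N in y_odd *.
rewrite -(odd_double_half y) y_odd.
have -> : ((true + y./2.*2) ^ 2).+1 = ((y./2 ^ 2 + y./2).*2.+1).*2 by nia.
by rewrite logn2_double_odd //= odd_double.
Qed.

Lemma card_Per_sqr_ratio (R : realType) (F : finFieldType) q k :
  #|F| = q -> logn 2 q.-1 = k ->
  (card_Per 'X^2 F)%:R / q%:R
  = 1 / 2 ^+ k + (1 - 1 / 2 ^+ k) / q%:R :> R.
Proof.
move=> Fq kE; have q_gt1 : (1 < q)%N by rewrite -Fq finNzRing_gt1.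
have : (2 ^ k * (q.-1)`_(2^')%N = q.-1)%N by rewrite -kE -p_part partnC //; lia.
rewrite card_Per_sqr Fq; move: (_`_(2^'))%N => m qE.
(* With [q] eliminated, the claim is a rational identity in 2^k and [m]. *)
have -> : q = (2 ^ k * m).+1 by lia.
rewrite -(natr1 m) -(natr1 (_ * _)) natrM natrX.
have : 2 ^+ k * m%:R + 1 != 0 :> R by rewrite -natrX -natrM natr1 pnatr_eq0.
have : 2 ^+ k != 0 :> R by rewrite expf_neq0 ?pnatr_eq0.
move: (2 ^+ k) => a a_neq0 q_neq0; field.
by rewrite a_neq0 q_neq0.
Qed.

Lemma cvg_card_Per_sqr (R : realType) (p : nat) (F : nat -> finFieldType)
    (A : set nat) (k : nat) :
  (1 < p)%N -> (forall n, (0 < n)%N -> #|F n| = (p ^ n)%N) ->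
  (forall n, A n -> (0 < n)%N /\ logn 2 (p ^ n).-1 = k) ->
  (card_Per ('X^2 : {poly int}) (F n))%:R / p%:R ^+ n
    @[n --> within A \oo] --> (1 / 2 ^+ k : R).
Proof.
move=> p_gt1 cardF Ak.
(* [g] converges along all [n] and agrees with the ratio on [A], so its limit passes to the
   restricted filter. *)
pose g n : R := 1 / 2 ^+ k + (1 - 1 / 2 ^+ k) * p%:R^-1 ^+ n.
have g_cvg : g n @[n --> \oo] --> (1 / 2 ^+ k : R).
  rewrite -[X in _ --> X]addr0 -[X in _ + X](mulr0 (1 - 1 / 2 ^+ k)).
  apply: cvgD; first exact: cvg_cst.
  apply: cvgM; first exact: cvg_cst.
  apply: cvg_expr; rewrite ger0_norm ?invr_ge0 //.
  by rewrite invf_lt1 ?ltr1n ?ltr0n //; lia.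
apply: cvg_trans (cvg_trans (cvg_app g (cvg_within A)) g_cvg).
apply: near_eq_cvg; rewrite near_withinE; apply: nearW => n /Ak[n_gt0 nk].
rewrite /g exprVn -(natrX _ p).
by rewrite (@card_Per_sqr_ratio R (F n) _ _ (cardF n n_gt0) nk).
Qed.

Theorem theorem4p4 (R : realType) (p : nat) (p_prime : prime p) (p_odd : odd p)
    (lambda mu : nat)
    (lambdaE : logn 2 (p - 1)%N = lambda)
    (muE : maxn (logn 2 (p - 1)%N) (logn 2 (p + 1)%N) = mu)
    (F : nat -> finFieldType)
    (cardF : forall n : nat, (0 < n)%N -> #|F n| = (p ^ n)%N) :
  ((card_Per ('X^2 : {poly int}) (F n))%:R / (p%:R ^+ n) : R)
      @[n --> within (v2_eq 0) \oo] --> (1 / 2 ^+ lambda : R)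
  /\
  (forall nu : nat, (1 <= nu)%N ->
    ((card_Per ('X^2 : {poly int}) (F n))%:R / (p%:R ^+ n) : R)
      @[n --> within (v2_eq nu) \oo] --> (1 / 2 ^+ (mu + nu)%N : R)).
Proof.
have p_gt1 := prime_gt1 p_prime.
rewrite subn1 in lambdaE muE; rewrite addn1 in muE.
split=> [|nu nu_gt0]; apply: cvg_card_Per_sqr => // n [n_gt0 n_nu]; split=> //.
  (* Valuation 0 says that 2 does not divide [n], so the odd case applies. *)
  rewrite logn2_predX_odd // -coprime2n prime_coprime //.
  by rewrite -[2%N]expn1 pfactor_dvdn // n_nu.
by rewrite logn2_predX_even ?n_nu // muE.
Qed.
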